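(* Let $K$ be a group, $P$ a non-abelian group, and $S$ a subgroup of $P$ such that $S\cap Z(P)=\{1\}$, where $Z(P)$ is the centre of $P$. Let $g:K\to S$ be a map with $g(1)=1$ which is not a homomorphism and such that the set $\{(k,1,g(k)) : k\in K\}$ generates the group $K\times\{1\}\times S$. Let $G=K\times P\times S$, $H=\{(1,x,x) : x\in S\}\le G$ and $M=\{(k,\,l\,g(k),\,g(k)) : k\in K,\ l\in P\}\subset G$. Then: (1) Every left coset of $H$ in $G$ has the form $(a,b,1)H$ with unique $a\in K$, $b\in P$; the set $M$ is the image of the section $\sigma:G/H\to G$, $\sigma((x,y,1)H)=(x,\,y\,g(x),\,g(x))$; and $M$ acts sharply transitively on $G/H$, i.e. for all cosets $uH,vH$ there is exactly one $z\in M$ with $zuH=vH$. (2) The set $L=G/H$ with the multiplication $$(a_1,b_1,1)H\ast(a_2,b_2,1)H=(a_1a_2,\ b_1\,g(a_1)\,b_2\,g(a_1)^{-1},\ 1)H$$ is a proper loop for which $G$ is the group generated by the left translations, $H$ is the stabilizer of the identity $e\in L$, and $M$ is the set of all left translations. (3) $N=\{(1,l,1)H : l\in P\}$ is a normal subloop of $(L,\ast)$ which is a group isomorphic to $P$, the set $\{(k,1,1)H : k\in K\}$ is a subgroup of $(L,\ast)$ isomorphic to $K$, and $(L,\ast)$ is a semidirect product of the normal subgroup $N$ by this subgroup. (4) If $K$ and $P$ are connected Lie groups and $g$ is continuous, then $L$ is a connected locally compact topological proper loop. If moreover $g$ is differentiable, then $L$ is a connected almost differentiable proper loop.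
   Context: A loop is a set $L$ with a binary operation having a two-sided identity $e$ such that for all $a,b\in L$ each of the equations $a\cdot y=b$ and $x\cdot a=b$ has exactly one solution, denoted $y=a\backslash b$ and $x=b/a$. A loop is proper if it is not a group (i.e. not associative). The left translation by $a\in L$ is the bijection $\lambda_a:L\to L$, $y\mapsto a\cdot y$. The group $G$ acts on $G/H$ by left multiplication; this action is faithful because $H$ contains no non-trivial normal subgroup of $G$, so $G$ and $M$ are identified with the corresponding groups/sets of permutations of $G/H$. A subloop $N$ of a loop $(L,\circ)$ is normal if $x\circ N=N\circ x$, $(x\circ N)\circ y=x\circ(N\circ y)$ and $x\circ(y\circ N)=(x\circ y)\circ N$ for all $x,y\in L$. A loop $L$ is a product of two subloops $L_1,L_2$ if every element of $L$ has the form $a\cdot b$ with $a\in L_1$, $b\in L_2$. It is a semidirect product of a normal subgroup $N$ by a subgroup $Q$ if $N$ is normal in $L$, $L$ is the product of $N$ and $Q$, and $N\cap Q=\{e\}$. A topological loop is a loop on a topological space whose multiplication, left division $(x,y)\mapsto x\backslash y$ and right division $(x,y)\mapsto y/x$ are continuous. A loop is almost differentiable if it is a differentiable manifold and its multiplication and left division are differentiable. In (4), $L$ carries the topology/differentiable structure of $K\times P$ via $(a,b)\mapsto(a,b,1)H$, and continuity/differentiability of $g$ is understood as that of a map $K\to P$. *)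

(* Defs.v *)
From HB Require Import structures.
From mathcomp Require Import all_boot all_order all_algebra.
From mathcomp Require Import all_classical all_reals all_analysis.

Set Implicit Arguments.
Unset Strict Implicit.
Unset Printing Implicit Defensive.

Import numFieldNormedType.Exports.
Local Open Scope classical_set_scope.

Section Subgroups.
Variable G : groupType.
Local Open Scope group_scope.

Definition is_subgroup (A : set G) : Prop :=
  [/\ A 1, forall x y, A x -> A y -> A (x * y) & forall x, A x -> A x^-1].

Definition generated (X : set G) : set G :=
  \bigcap_(A in [set A | is_subgroup A /\ X `<=` A]) A.

Definition group_center : set G := [set z | forall x, z * x = x * z].

Definition lcoset_set (H : set G) (u : G) : set G := [set u * h | h in H].

Definition lcosets (H : set G) : Type :=
  {A : set G | exists u, A = lcoset_set H u}.

Definition lcoset (H : set G) (u : G) : lcosets H :=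
  exist _ (lcoset_set H u) (ex_intro _ u erefl).

Lemma lcoset_translate (H : set G) (z : G) (A : lcosets H) :
  exists u, [set z * x | x in sval A] = lcoset_set H u.
Proof.
case: A => A [u defA]; exists (z * u); rewrite /= defA; apply/seteqP; split => x /=.
  by move=> [_ [h Hh <-] <-]; exists h; rewrite ?mulgA.
by move=> [h Hh <-]; exists (u * h); [exists h | rewrite mulgA].
Qed.

Definition lcoset_act (H : set G) (z : G) (A : lcosets H) : lcosets H :=
  exist _ [set z * x | x in sval A] (lcoset_translate z A).

End Subgroups.

(* The group of permutations of [T] generated by a set of bijections [X]. *)
Definition perm_generated (T : Type) (X : set (T -> T)) : set (T -> T) :=
  \bigcap_(A in [set A : set (T -> T) |
     [/\ X `<=` A, A id, forall f h, A f -> A h -> A (f \o h) &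
         forall f h, A f -> cancel f h -> cancel h f -> A h]]) A.

Section SubgroupType.
Variables (P : groupType) (S : groupClosed P).

Definition subg : Type := {x : P | x \in S}.

HB.instance Definition _ := SubChoice.on subg.

Lemma subg_closed : group_closed (mem S).
Proof. by split; [exact: gpred1 | exact: gpredF]. Qed.

HB.instance Definition _ :=
  SubChoice_isSubGroup.Build P (mem S) subg subg_closed.

End SubgroupType.

Section Loops.
Variables (L : choiceType) (op : L -> L -> L) (e : L).

Definition is_loop : Prop :=
  [/\ forall x, op e x = x /\ op x e = x,
      forall a b, exists! y, op a y = b
    & forall a b, exists! x, op x a = b].

Definition proper_loop : Prop := is_loop /\ ~ associative op.

(* a \ b; the default value [e] is never used when [op] is a loop. *)
Definition ldiv (a b : L) : L := xget e [set y | op a y = b].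

(* Note the order of the arguments: [rdiv b a] is b / a. *)
Definition rdiv (b a : L) : L := xget e [set x | op x a = b].

Definition subloop (N : set L) : Prop :=
  N e /\ forall x y, N x -> N y ->
    [/\ N (op x y), N (ldiv x y) & N (rdiv x y)].

Definition normal_subloop (N : set L) : Prop :=
  subloop N /\ forall x y,
    [/\ [set op x n | n in N] = [set op n x | n in N],
        [set op (op x n) y | n in N] = [set op x (op n y) | n in N]
      & [set op x (op y n) | n in N] = [set op (op x y) n | n in N]].

Definition assoc_on (N : set L) : Prop :=
  forall x y z, N x -> N y -> N z -> op x (op y z) = op (op x y) z.

Definition loop_subgroup (Q : set L) : Prop := subloop Q /\ assoc_on Q.

Definition isomorphic_to_group (N : set L) (P : groupType) : Prop :=
  exists f : P -> L, [/\ {morph f : x y / (x * y)%g >-> op x y},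
                         injective f & range f = N].

Definition loop_product (L1 L2 : set L) : Prop :=
  forall x, exists a b, [/\ L1 a, L2 b & x = op a b].

Definition semidirect_product (N Q : set L) : Prop :=
  [/\ normal_subloop N, assoc_on N, loop_subgroup Q, loop_product N Q
    & N `&` Q = [set e]].

End Loops.

Definition topological_loop (L : topologicalType) (op : L -> L -> L) (e : L) :=
  [/\ is_loop op e, continuous (fun p : L * L => op p.1 p.2),
      continuous (fun p : L * L => ldiv op e p.1 p.2)
    & continuous (fun p : L * L => rdiv op e p.2 p.1)].

(* [Diff] is Fréchet differentiability, [CS k] is the class C^(k+1), [Cinf] is
   the class C^oo. *)
Variant diff_class := Diff | CS of nat | Cinf.

Section Smoothness.
Variables (R : realType) (V W : normedModType R).

Fixpoint Ck (k : nat) (U : set V) (f : V -> W) : Prop :=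
  if k is k'.+1 then
    (forall x, U x -> differentiable f x) /\
    forall v, Ck k' U (fun x => 'D_v f x)
  else forall x, U x -> {for x, continuous f}.

(* Meant for open [U]. *)
Definition of_class (r : diff_class) (U : set V) (f : V -> W) : Prop :=
  match r with
  | Diff => forall x, U x -> differentiable f x
  | CS k => Ck k.+1 U f
  | Cinf => forall k, Ck k U f
  end.

End Smoothness.

(* [cinv] matters only on [ccod], where it is the inverse of [cmap]. *)
Record chart (R : realType) (T : Type) (n : nat) := Chart {
  cdom : set T;
  cmap : T -> 'rV[R]_n;
  cinv : 'rV[R]_n -> T
}.

Section Manifolds.
Variable R : realType.

Definition ccod (T : Type) n (c : chart R T n) : set 'rV[R]_n :=
  cmap c @` cdom c.

Definition is_chart (T : topologicalType) n (c : chart R T n) : Prop :=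
  [/\ open (cdom c), open (ccod c),
      forall x, cdom c x -> cinv c (cmap c x) = x,
      forall x, cdom c x -> {for x, continuous (cmap c)}
    & forall y, ccod c y -> {for y, continuous (cinv c)}].

Definition differentiable_manifold (T : topologicalType) n
    (A : set (chart R T n)) : Prop :=
  [/\ hausdorff_space T, @second_countable T, forall c, A c -> is_chart c,
      forall x, exists2 c, A c & cdom c x
    & forall c d, A c -> A d ->
        of_class Cinf (cmap c @` (cdom c `&` cdom d)) (cmap d \o cinv c)].

Definition map_of_class (r : diff_class) (T U : topologicalType) n m
    (A : set (chart R T n)) (B : set (chart R U m)) (f : T -> U) : Prop :=
  continuous f /\ forall c d, A c -> B d ->
    of_class r (cmap c @` (cdom c `&` f @^-1` cdom d)) (cmap d \o f \o cinv c).

Definition prod_chart (T U : Type) n m (c : chart R T n) (d : chart R U m) :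
    chart R (T * U) (n + m) :=
  Chart (cdom c `*` cdom d)
        (fun x => row_mx (cmap c x.1) (cmap d x.2))
        (fun v => (cinv c (lsubmx v), cinv d (rsubmx v))).

Definition prod_atlas (T U : Type) n m
    (A : set (chart R T n)) (B : set (chart R U m)) :
    set (chart R (T * U) (n + m)) :=
  [set prod_chart c d | c in A & d in B].

(* Transport along a bijection [phi] with inverse [psi]. *)
Definition transport_atlas (T U : Type) n (phi : T -> U) (psi : U -> T)
    (A : set (chart R T n)) : set (chart R U n) :=
  [set Chart (phi @` cdom c) (cmap c \o psi) (phi \o cinv c) | c in A].

Definition almost_differentiable_loop (r : diff_class) (L : topologicalType) n
    (A : set (chart R L n)) (op : L -> L -> L) (e : L) : Prop :=
  [/\ is_loop op e, differentiable_manifold A,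
      map_of_class r (prod_atlas A A) A (fun p : L * L => op p.1 p.2)
    & map_of_class r (prod_atlas A A) A (fun p : L * L => ldiv op e p.1 p.2)].

End Manifolds.

(* No compatibility between the operations and the topology is required at
   this level: it is part of the Lie group axioms. *)
#[short(type="groupTopologicalType")]
HB.structure Definition GroupTopological := {G of Group G & Topological G}.

HB.mixin Record isLieGroup (R : realType) G of GroupTopological G := {
  lie_dim : nat;
  lie_atlas : set (chart R G lie_dim);
  lie_manifold : differentiable_manifold lie_atlas;
  lie_mul_smooth : map_of_class Cinf (prod_atlas lie_atlas lie_atlas) lie_atlas
                     (fun p : G * G => (p.1 * p.2)%g);
  lie_inv_smooth : map_of_class Cinf lie_atlas lie_atlas (fun x : G => x^-1%g)
}.

#[short(type="lieGroupType")]
HB.structure Definition LieGroup (R : realType) :=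
  {G of isLieGroup R G & GroupTopological G}.

Section Construction.
Variables (K P : groupType) (S : groupClosed P) (g : K -> subg S).
Local Open Scope group_scope.

Definition Ggrp : groupType := (K * P * subg S)%type.

Definition data_hyp : Prop :=
  [/\ ~ (forall x y : P, x * y = y * x),
      [set x | x \in S] `&` @group_center P = [set 1],
      g 1 = 1,
      ~ {morph g : x y / x * y}
    & generated [set ((k, 1, g k) : Ggrp) | k in [set: K]]
      = [set u | u.1.2 = 1]].

Definition Hsub : set Ggrp :=
  [set ((1, val x, x) : Ggrp) | x in [set: subg S]].

Definition Mset : set Ggrp :=
  [set ((k, l * val (g k), g k) : Ggrp) | k in [set: K] & l in [set: P]].

End Construction.

Section LoopOfCosets.
Variables (K P : groupType) (S : groupClosed P).
Local Open Scope group_scope.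

Definition GmodH : Type := lcosets (@Hsub K P S).

HB.instance Definition _ := gen_eqMixin GmodH.
HB.instance Definition _ := gen_choiceMixin GmodH.

Definition cosetH (u : Ggrp K S) : GmodH := lcoset (@Hsub K P S) u.

Definition actG (z : Ggrp K S) (A : GmodH) : GmodH := lcoset_act z A.

(* (a, b) |-> (a, b, 1) H *)
Definition std_coset (p : K * P) : GmodH := cosetH (p, 1).

(* Inverse of the bijection [std_coset]. *)
Definition coord (A : GmodH) : K * P := xget 1 [set p | std_coset p = A].

Definition loop_op (g : K -> subg S) (A B : GmodH) : GmodH :=
  let: (a1, b1) := coord A in let: (a2, b2) := coord B in
  std_coset (a1 * a2, b1 * val (g a1) * b2 * (val (g a1))^-1).

End LoopOfCosets.

Arguments GmodH : clear implicits.
Arguments cosetH {K P S} u.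
Arguments std_coset {K P S} p.

Section TopologyOnCosets.
Variables (K P : groupTopologicalType) (S : groupClosed P).

(* The topology of K * P carried over along the bijection [std_coset]. *)
Definition GmodH_open : set (set (GmodH K P S)) :=
  [set U | open (std_coset @^-1` U : set (K * P))].

Lemma GmodH_openT : GmodH_open setT.
Proof. exact: openT. Qed.

Lemma GmodH_openI : setI_closed GmodH_open.
Proof. by move=> U V oU oV; apply: openI. Qed.

Lemma GmodH_open_bigU (I : Type) (f : I -> set (GmodH K P S)) :
  (forall i, GmodH_open (f i)) -> GmodH_open (\bigcup_i f i).
Proof.
by move=> fop; rewrite /GmodH_open /= preimage_bigcup; apply: bigcup_open => i _; exact: fop.
Qed.

HB.instance Definition _ := isOpenTopological.Build (GmodH K P S)
  GmodH_openT GmodH_openI GmodH_open_bigU.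

End TopologyOnCosets.

Definition GmodH_atlas (R : realType) (K P : lieGroupType R)
    (S : groupClosed P) :=
  transport_atlas (@std_coset K P S) (@coord K P S)
    (prod_atlas (@lie_atlas R K) (@lie_atlas R P)).

Arguments GmodH_atlas {R} K {P} S.

(* Main.v *)
Require Import Defs.
From mathcomp Require Import all_boot all_order all_algebra.
From mathcomp Require Import all_classical all_reals all_analysis.
Local Open Scope classical_set_scope.
Local Open Scope group_scope.

(** Every coset is [(a, b, 1)H] for a unique [(a, b)], and left translation by
    [(a, b, 1)H] is the action of [(a, b g(a), g(a))]. Associativity would make
    [(g(x) g(y))^-1 g(xy)] central in [P], hence trivial since it lies in [S],
    so that [g] would be a homomorphism. Normality of [N] holds because [N] is
    the kernel of the loop homomorphism [(a, b, 1)H |-> a].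

    For (4), the multiplication and the divisions are given in the coordinates
    [(a, b)] by words in [g] and in the group operations of [K] and [P], so it
    suffices that maps of class [r] between manifolds are closed under
    composition and pairing. In charts this is the chain rule, which for [C^k]
    maps goes by induction on [k] from
    [D_v (h o f) = sum_i (D_v f)_i * ((D_{e_i} h) o f)]. *)

Set Implicit Arguments.
Unset Strict Implicit.
Unset Printing Implicit Defensive.

(** * The coset loop *)

Section Cosets.
Context {K P : groupType} {S : groupClosed P}.

Lemma subg1 : val (1 : subg S) = 1. Proof. exact: gmulf1. Qed.

Lemma subgM (x y : subg S) : val (x * y) = val x * val y.
Proof. exact: gmulfM. Qed.

Lemma subgV (x : subg S) : val x^-1 = (val x)^-1.
Proof. exact: (gmulfV (\val : subg S -> P)). Qed.

(** A coset is bundled with a proof that it is one; proof irrelevance leaves only the underlying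
    sets to compare. *)
Lemma lcosets_eq (G : groupType) (H : set G) (A B : lcosets H) :
  sval A = sval B -> A = B.
Proof.
move: A B => [A pA] [B pB] /= eAB; subst B.
by congr exist; exact: Prop_irrelevance.
Qed.

Lemma actG_cosetH (z u : Ggrp K S) : actG z (cosetH u) = cosetH (z * u).
Proof.
apply: lcosets_eq; apply/seteqP; split => x /=.
  by move=> [_ [h Hh <-] <-]; exists h; rewrite ?mulgA.
by move=> [h Hh <-]; exists (u * h); [exists h | rewrite mulgA].
Qed.

(** Right multiplication by the element [(1, (val s)^-1, s^-1)] of [H] clears the third component,
    so every coset has a standard representative. *)
Lemma cosetHE (a : K) (b : P) (s : subg S) :
  cosetH (a, b, s) = std_coset (a, b * (val s)^-1) :> GmodH K P S.
Proof.
apply: lcosets_eq; apply/seteqP; split => _ [_ [x _ <-] <-].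
- exists (1, val (s * x), s * x); first by exists (s * x).
  by congr (_, _, _); rewrite ?mul1g// subgM mulgA mulgVK.
- exists (1, val (s^-1 * x), s^-1 * x); first by exists (s^-1 * x).
  by congr (_, _, _); rewrite ?mulVKg ?mul1g// subgM subgV mulgA.
Qed.

(** The element [(c, d, 1) * (1, val x, x)] has third component [x]; if it equals [(a, b, 1)], then
    [x = 1] and the remaining components agree. *)
Lemma std_coset_inj : injective (@std_coset K P S).
Proof.
move=> [a b] [c d] /(congr1 sval)/= E.
have : lcoset_set (@Hsub K P S) (c, d, 1) (a, b, 1).
  rewrite -E; exists (1, 1, 1); first by exists 1; rewrite ?subg1.
  by congr (_, _, _); rewrite mulg1.
move=> [_ [x _ <-]] [<- <-]; rewrite mul1g => x1.
by rewrite (_ : val x = 1) ?mulg1// x1; exact: subg1.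
Qed.

Lemma coordK : cancel (@Defs.coord K P S) std_coset.
Proof.
move=> A; rewrite /Defs.coord; case: xgetP => [p _ //|]; case: A => A [[[a b] s] defA].
(* The default branch of [xget] is impossible, since the standard representative is a witness. *)
move=> /(_ (a, b * (val s)^-1))[]; rewrite /= -cosetHE.
exact: lcosets_eq.
Qed.

Lemma std_cosetK : cancel (@std_coset K P S) (@Defs.coord K P S).
Proof. by move=> p; apply: std_coset_inj; rewrite coordK. Qed.

Lemma actG_std_coset a b s c d :
  actG (a, b, s) (std_coset (c, d)) =
  std_coset (a * c, b * d * (val s)^-1) :> GmodH K P S.
Proof. by rewrite actG_cosetH -cosetHE /= -[s in RHS]mulg1. Qed.

End Cosets.

(** * Divisions, properness, and the group generated by the left translations *)

Section CosetLoop.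
Context {K P : groupType} {S : groupClosed P} (g : K -> subg S).
Let op := loop_op g.
Let e : GmodH K P S := std_coset (1, 1).

Lemma loop_opE a1 a2 b1 b2 :
  loop_op g (std_coset (a1, b1)) (std_coset (a2, b2)) =
  std_coset (a1 * a2, b1 * val (g a1) * b2 * (val (g a1))^-1).
Proof. by rewrite /loop_op !std_cosetK. Qed.

Lemma loop_op_actG a b :
  loop_op g (std_coset (a, b)) = actG (a, b * val (g a), g a).
Proof.
apply/funext => A; rewrite -(coordK A); case: (Defs.coord A) => c d.
by rewrite loop_opE actG_std_coset.
Qed.

Definition loop_ldiv (A B : GmodH K P S) : GmodH K P S :=
  let: (a1, b1) := Defs.coord A in let: (a2, b2) := Defs.coord B in
  std_coset (a1^-1 * a2, (val (g a1))^-1 * (b1^-1 * b2) * val (g a1)).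

(** The first coordinate [c] of the quotient is found first, because the equation for the second one
    involves [g] at the unknown left factor. *)
Definition loop_rdiv (B A : GmodH K P S) : GmodH K P S :=
  let: (a1, b1) := Defs.coord A in let: (a2, b2) := Defs.coord B in
  let c := a2 * a1^-1 in
  std_coset (c, b2 * (val (g c) * b1^-1 * (val (g c))^-1)).

Lemma loop_opKV A : cancel (loop_ldiv A) (op A).
Proof.
move=> B; rewrite -[A]coordK -[B]coordK.
case: (Defs.coord A) (Defs.coord B) => a b [c d]; rewrite /op /loop_ldiv !std_cosetK.
by rewrite loop_opE mulVKg !mulgA !mulgK mulgV mul1g.
Qed.

Lemma loop_opK A : cancel (op A) (loop_ldiv A).
Proof.
move=> B; rewrite -[A]coordK -[B]coordK.
case: (Defs.coord A) (Defs.coord B) => a b [c d]; rewrite /op loop_opE /loop_ldiv !std_cosetK.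
by rewrite mulKg !mulgA !mulgVK mulVg mul1g.
Qed.

Lemma loop_rdivK A : cancel (op^~ A) (loop_rdiv^~ A).
Proof.
move=> B; rewrite -[A]coordK -[B]coordK.
case: (Defs.coord A) (Defs.coord B) => a b [c d]; rewrite /op loop_opE /loop_rdiv !std_cosetK.
by rewrite mulgK !mulgA !(mulgK, mulgVK).
Qed.

Lemma loop_rdivKV A : cancel (loop_rdiv^~ A) (op^~ A).
Proof.
move=> B; rewrite -[A]coordK -[B]coordK.
case: (Defs.coord A) (Defs.coord B) => a b [c d]; rewrite /op /loop_rdiv !std_cosetK.
by rewrite loop_opE mulgVK !mulgA !(mulgK, mulgVK).
Qed.

Hypothesis gdata : data_hyp g.

Lemma data_g1 : val (g 1) = 1.
Proof. by case: gdata => _ _ -> _ _; rewrite subg1. Qed.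

Lemma loop_op_is_loop : is_loop op e.
Proof.
split=> [A|A B|A B].
- rewrite -[A]coordK; case: (Defs.coord A) => a b; rewrite /op /e !loop_opE data_g1.
  by rewrite invg1 !mulg1 !mul1g mulgK.
- exists (loop_ldiv A B); split => [|y <-]; first exact: loop_opKV.
  exact: loop_opK.
- exists (loop_rdiv B A); split => [|y <-]; first exact: loop_rdivKV.
  exact: loop_rdivK.
Qed.

(** Whatever solution [xget] picks is the explicit one by cancellation, and [loop_opKV] rules out
    the default value. *)
Lemma ldiv_loop_op A B : ldiv op e A B = loop_ldiv A B.
Proof.
rewrite /ldiv; case: xgetP => [y _ /= <-|/(_ (loop_ldiv A B))[]];
  last exact: loop_opKV.
by rewrite loop_opK.
Qed.

Lemma rdiv_loop_op A B : rdiv op e B A = loop_rdiv B A.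
Proof.
rewrite /rdiv; case: xgetP => [y _ /= <-|/(_ (loop_rdiv B A))[]];
  last exact: loop_rdivKV.
by rewrite (loop_rdivK A).
Qed.

(** The form in which the triviality of the intersection of [S] with the centre is used, both for
    non-associativity and for faithfulness. *)
Lemma val_central_eq1 (s : subg S) :
  (forall y, val s * y = y * val s) -> s = 1.
Proof.
case: gdata => _ /seteqP[SZ _] _ _ _ sZ; apply: val_inj; rewrite subg1.
by apply: SZ; split => //; exact: (valP s).
Qed.

Lemma loop_op_not_assoc : ~ associative op.
Proof.
case: gdata => _ _ _ ghom _ opA; apply: ghom => x y.
suff /mulg1_eq : (g x * g y)^-1 * g (x * y) = 1 by rewrite invgK.
apply: val_central_eq1 => b.
(* On this triple, associativity says that [g x * g y] and [g (x * y)] conjugate [b] to the same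
   element. *)
move: (opA (std_coset (x, 1)) (std_coset (y, 1)) (std_coset (1, b))).
rewrite /op !loop_opE => /std_coset_inj[_].
rewrite !mul1g !mulg1 !mulgV mul1g => E.
rewrite !(subgM, subgV).
set h := val (g x) * val (g y); set k := val (g (x * y)).
have {}E : h * b * h^-1 = k * b * k^-1 by rewrite invgM !mulgA; rewrite !mulgA in E.
(* Multiplying by [h] on the left and by [k^-1] on the right turns the commutation of [h^-1 * k]
   with [b] into [E]. *)
apply: (@mulgI _ h); apply: (@mulIg _ k^-1).
by rewrite !mulgA mulgV mul1g mulgK E.
Qed.

Lemma loop_op_proper : proper_loop op e.
Proof. by split; [exact: loop_op_is_loop | exact: loop_op_not_assoc]. Qed.

(** If [(a, b, s)] fixes every coset, then [b * y = y * val s] for all [y]. Taking [y = 1] gives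
    [b = val s], so [s] is central in [P], hence trivial, and fixing [e] gives [a = 1]. *)
Lemma actG_inj : injective (@actG K P S).
Proof.
have act1 z : (forall A : GmodH K P S, actG z A = A) -> z = 1.
  case: z => -[a b] s zfix.
  have zE y : b * y = y * val s.
    move: (zfix (std_coset (1, y))); rewrite actG_std_coset.
    by move=> /std_coset_inj[_ {2}<-]; rewrite mulgVK.
  have bE : b = val s by rewrite -[b]mulg1 zE mul1g.
  have s1 : s = 1 by apply: val_central_eq1 => y; rewrite -zE bE.
  move: (zfix (std_coset (1, 1))); rewrite actG_std_coset.
  by move=> /std_coset_inj[+ _]; rewrite mulg1 bE s1 subg1 => ->.
move=> y z yz; rewrite -[y]invgK; apply: mulg1_eq; apply: act1 => A.
have : actG y (std_coset (Defs.coord A)) = actG z (std_coset (Defs.coord A)).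
  by rewrite yz.
rewrite -[A in _ -> actG _ A = A]coordK.
rewrite /std_coset !actG_cosetH => E; rewrite -mulgA -actG_cosetH -E.
by rewrite actG_cosetH mulKg.
Qed.

(** Since [g 1 = 1], [M] contains the whole factor [P]. Dividing its elements by their [P]-part
    leaves the triples [(k, 1, g k)], which generate the other two factors by hypothesis. *)
Lemma Mset_generates (A : set (Ggrp K S)) :
  is_subgroup A -> Mset g `<=` A -> A = setT.
Proof.
move=> Agrp MA; have [A1 AM AV] := Agrp; rewrite -subTset => -[[k p] s] _.
have AP l : A (1, l, 1).
  apply: MA; exists 1 => //; exists l => //.
  by case: gdata => _ _ -> _ _; rewrite subg1 mulg1.
have AKS : [set u : Ggrp K S | u.1.2 = 1] `<=` A.
  case: gdata => _ _ _ _ <-; apply: bigcap_inf; split => // _ [c _ <-].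
  rewrite (_ : (c, 1, g c) = (1, (val (g c))^-1, 1) * (c, val (g c), g c)).
    apply: AM; first exact: AP.
    by apply: MA; exists c => //; exists 1 => //; rewrite mul1g.
  by congr (_, _, _); rewrite ?mul1g ?mulVg.
rewrite (_ : (k, p, s) = (1, p, 1) * (k, 1, s)).
  by apply: AM; [exact: AP | exact: AKS].
by congr (_, _, _); rewrite ?mul1g ?mulg1.
Qed.

Lemma range_loop_op : range op = [set actG z | z in Mset g].
Proof.
apply/seteqP; split => [_ [A _ <-]|_ [_ [k _ [l _ <-]] <-]].
  rewrite -[A]coordK; case: (Defs.coord A) => a b; rewrite /op loop_op_actG.
  by eexists; [exists a => //; exists b|].
by exists (std_coset (k, l)); rewrite // /op loop_op_actG.
Qed.

Lemma actG1 : actG (1 : Ggrp K S) = id.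
Proof.
by apply/funext => A; rewrite -[A]coordK /std_coset actG_cosetH mul1g.
Qed.

Lemma actGM (y z : Ggrp K S) : actG (y * z) = actG y \o actG z.
Proof.
apply/funext => A; rewrite -[A]coordK /std_coset /=.
by rewrite !actG_cosetH mulgA.
Qed.

(** The permutations induced by [G] are closed under composition and inverses, which gives one
    inclusion. Conversely, any competing family [B] pulls back along [actG] to a subgroup of [G]
    containing [M], hence to all of [G]. *)
Lemma perm_generated_loop_op : perm_generated (range op) = range (@actG K P S).
Proof.
apply/seteqP; split => [|_ [z _ <-] B [MB B1 BM BV]].
  apply: bigcap_inf; split => [| |f h [y _ <-] [z _ <-]|_ h [z _ <-] zh hz].
  - by rewrite range_loop_op => _ [z _ <-]; exists z.
  - by exists 1; rewrite ?actG1.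
  - by exists (y * z); rewrite ?actGM.
  (* The inverse is given only as a function [zh] cancels with; it has to be identified with the
     action of [z^-1]. *)
  - exists z^-1 => //; apply/funext => A.
    by rewrite -[A in LHS]hz -[LHS]/((actG z^-1 \o actG z) _) -actGM mulVg actG1.
suff : [set z | B (actG z)] = setT by move=> BT; have : setT z by []; rewrite -BT.
apply: Mset_generates => [|y My]; last by apply: MB; rewrite range_loop_op; exists y.
split => [|x y Bx By|x Bx] /=; first by rewrite actG1.
- by rewrite actGM; exact: BM.
- apply: (BV _ _ Bx) => A;
  by rewrite -[LHS]/((_ \o _) A) -actGM (mulVg, mulgV) actG1.
Qed.

Lemma Hsub_stabilizer : @Hsub K P S = [set z | actG z e = e].
Proof.
apply/seteqP; split => [_ [x _ <-]|[[a b] s]] /=.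
  by rewrite /e actG_std_coset !mulg1 mulgV.
rewrite /e actG_std_coset => /std_coset_inj[]; rewrite !mulg1 => -> bs.
by exists s => //; rewrite -[val s]mul1g -bs mulgVK.
Qed.

Lemma std_coset_exists_unique (A : GmodH K P S) :
  exists! p : K * P, A = std_coset p.
Proof.
exists (Defs.coord A); split=> [|p ->]; first by rewrite coordK.
by rewrite std_cosetK.
Qed.

(** The value [(x, y * val (g x), g x)] is [(x, y, 1)] times the element [(1, val (g x), g x)] of
    [H], so it stays in the coset. *)
Lemma Mset_section : exists sigma : GmodH K P S -> Ggrp K S,
  [/\ forall A, cosetH (sigma A) = A,
      forall (x : K) (y : P), sigma (std_coset (x, y)) = (x, y * val (g x), g x)
    & range sigma = Mset g].
Proof.
pose sigma (A : GmodH K P S) : Ggrp K S :=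
  let: (x, y) := Defs.coord A in (x, y * val (g x), g x).
have sigmaE x y : sigma (std_coset (x, y)) = (x, y * val (g x), g x).
  by rewrite /sigma std_cosetK.
exists sigma; split => // [A|].
  by rewrite -[A]coordK; case: (Defs.coord A) => x y; rewrite sigmaE cosetHE mulgK.
apply/seteqP; split => [_ [A _ <-]|_ [x _ [y _ <-]]].
  rewrite -[A]coordK; case: (Defs.coord A) => x y; rewrite sigmaE.
  by exists x => //; exists y.
by exists (std_coset (x, y)).
Qed.

(** Elements of [M] act as left translations, so this is the unique solvability of [op C A = B];
    faithfulness of the action passes from the translation back to the element [z]. *)
Lemma Mset_sharply_transitive (A B : GmodH K P S) :
  exists! z, Mset g z /\ actG z A = B.
Proof.
have opA : exists! C, op C A = B by have [_ _] := loop_op_is_loop.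
case: opA => C [<- Cuniq]; have := range_loop_op => /seteqP[opM Mop].
have [|z Mz zE] := opM (op C); first by exists C.
exists z; split; first by rewrite zE.
move=> y [My yE]; apply: actG_inj; rewrite zE.
have [|D _ DE] := Mop (actG y); first by exists y.
by rewrite (Cuniq D) // DE.
Qed.

(** * The projection onto [K], its kernel [N], and the semidirect decomposition *)

Definition kcoord (A : GmodH K P S) : K := (Defs.coord A).1.

Lemma kcoord_op A B : kcoord (op A B) = kcoord A * kcoord B.
Proof.
rewrite /kcoord /op /loop_op.
by case: (Defs.coord A) (Defs.coord B) => a b [c d]; rewrite std_cosetK.
Qed.

Lemma kcoord_ldiv A B : kcoord (loop_ldiv A B) = (kcoord A)^-1 * kcoord B.
Proof.
rewrite /kcoord /loop_ldiv.
by case: (Defs.coord A) (Defs.coord B) => a b [c d]; rewrite std_cosetK.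
Qed.

Lemma kcoord_rdiv A B : kcoord (loop_rdiv B A) = kcoord B * (kcoord A)^-1.
Proof.
rewrite /kcoord /loop_rdiv.
by case: (Defs.coord A) (Defs.coord B) => a b [c d]; rewrite std_cosetK.
Qed.

Let N : set (GmodH K P S) := [set std_coset (1, l) | l in [set: P]].
Let Q : set (GmodH K P S) := [set std_coset (k, 1) | k in [set: K]].

Lemma kernel_kcoord : N = [set A | kcoord A = 1].
Proof.
apply/seteqP; split => [_ [l _ <-]|A] /=; first by rewrite /kcoord std_cosetK.
rewrite /kcoord -[A in N A]coordK; case: (Defs.coord A) => a b /= ->.
by exists b.
Qed.

(** For each of the six inclusions the required element is obtained by dividing in the loop, and its
    image under [kcoord] is then computed in [K] to be [1]. *)
Lemma N_normal : normal_subloop op e N.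
Proof.
rewrite kernel_kcoord; split.
  split; first by rewrite /= /kcoord std_cosetK.
  move=> A B /= A1 B1; rewrite ldiv_loop_op rdiv_loop_op.
  by rewrite kcoord_op kcoord_ldiv kcoord_rdiv A1 B1 invg1 !mulg1.
move=> x y; split; apply/seteqP; split => _ [n /= n1 <-].
- exists (loop_rdiv (op x n) x); last exact: loop_rdivKV.
  by rewrite /= kcoord_rdiv kcoord_op n1 mulg1 mulgV.
- exists (loop_ldiv x (op n x)); last exact: loop_opKV.
  by rewrite /= kcoord_ldiv kcoord_op n1 mul1g mulVg.
- exists (loop_rdiv (loop_ldiv x (op (op x n) y)) y).
    by rewrite /= kcoord_rdiv kcoord_ldiv !kcoord_op n1 mulg1 mulKg mulgV.
  by rewrite loop_rdivKV loop_opKV.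
- exists (loop_ldiv x (loop_rdiv (op x (op n y)) y)).
    by rewrite /= kcoord_ldiv kcoord_rdiv !kcoord_op n1 mul1g mulgK mulVg.
  by rewrite loop_opKV loop_rdivKV.
- exists (loop_ldiv (op x y) (op x (op y n))); last exact: loop_opKV.
  by rewrite /= kcoord_ldiv !kcoord_op n1 mulg1 mulVg.
- exists (loop_ldiv y (loop_ldiv x (op (op x y) n))).
    by rewrite /= !kcoord_ldiv !kcoord_op n1 mulg1 mulKg mulVg.
  by rewrite !loop_opKV.
Qed.

Lemma N_isomorphic : isomorphic_to_group op N P.
Proof.
exists (fun l => std_coset (1, l)); split => // [x y|x y /std_coset_inj[]//].
by rewrite /op loop_opE data_g1 invg1 !mulg1.
Qed.

Lemma Q_isomorphic : isomorphic_to_group op Q K.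
Proof.
exists (fun k => std_coset (k, 1)); split => // [x y|x y /std_coset_inj[]//].
by rewrite /op loop_opE mul1g mulg1 mulgV.
Qed.

Lemma isomorphic_assoc_on (A : set (GmodH K P S)) (G : groupType) :
  isomorphic_to_group op A G -> assoc_on op A.
Proof.
move=> [f [fM _ <-]] _ _ _ [x _ <-] [y _ <-] [z _ <-].
by rewrite -!fM mulgA.
Qed.

Lemma Q_subgroup : loop_subgroup op e Q.
Proof.
split; last exact: isomorphic_assoc_on Q_isomorphic.
split; first by exists 1.
move=> _ _ [x _ <-] [y _ <-]; rewrite ldiv_loop_op rdiv_loop_op; split.
- by exists (x * y); rewrite // /op loop_opE mul1g mulg1 mulgV.
- by exists (x^-1 * y); rewrite // /loop_ldiv !std_cosetK mulVg mulg1 mulVg.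
- by exists (x * y^-1); rewrite // /loop_rdiv !std_cosetK invg1 mulg1 mulgV mulg1.
Qed.

Lemma semidirect_N_Q : semidirect_product op e N Q.
Proof.
split; [exact: N_normal|exact: isomorphic_assoc_on N_isomorphic|exact: Q_subgroup| |].
- move=> A; rewrite -[A]coordK; case: (Defs.coord A) => a b.
  (* With the factor from [N] on the left, [g] is evaluated at [1], so no conjugation appears. *)
  exists (std_coset (1, b)), (std_coset (a, 1)); split; [by exists b|by exists a|].
  by rewrite /op loop_opE data_g1 invg1 !mulg1 mul1g.
- apply/seteqP; split => [_ [[l _ <-] [k _ /std_coset_inj[_ <-]]]|_ ->] //.
  by split; exists 1.
Qed.

End CosetLoop.
(** * Calculus of C^k maps *)

Section Calculus.
Local Open Scope ring_scope.
Import Order.TTheory GRing.Theory Num.Theory numFieldNormedType.Exports.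
Context {R : realType} {V : normedModType R}.

(** Differentiability at [x] is a first-order expansion whose remainder depends only on the map near
    [x], so the expansion of [f] serves for [h]. *)
Lemma near_eq_differentiable (W : normedModType R) (f h : V -> W) (x : V) :
  (\near x, f x = h x) -> differentiable f x -> differentiable h x.
Proof.
move=> fh df; have fhx := nbhs_singleton fh.
have E : h \o shift x = cst (h x) + 'd f x +o_ 0 id.
  apply/eqaddoP => e e0.
  have /eqaddoP/(_ _ e0) := diff_locally df.
  have fh0 : \forall y \near 0, f (y + x) = h (y + x).
    move: fh; rewrite (near_shift 0); apply: filterS => y /=.
    by rewrite /shift subr0.
  apply: filterS2 fh0 => y /= E; rewrite -fhx.
  by rewrite /= !fctE /= E.
(* By uniqueness, the expansion [E] identifies ['d f x] with the differential of [h] at [x]. *)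
have c := diff_continuous df.
by apply/diff_locallyP; rewrite (diff_unique c E).
Qed.

(** Openness upgrades equality on [U] to equality near each of its points, which derivatives
    respect. *)
Lemma Ck_ext (W : normedModType R) k (U : set V) (f h : V -> W) : open U ->
  (forall x, U x -> f x = h x) -> Ck k U f -> Ck k U h.
Proof.
elim: k => [|k IH] in f h * => oU fh.
  move=> /= fc x Ux; change (h @ x --> h x); rewrite -fh//.
  apply: cvg_trans (fc x Ux); apply: near_eq_cvg.
  by near do rewrite fh//; exact: open_nbhs_nbhs.
move=> [fd fD]; have fhn x : U x -> \near x, f x = h x.
  by move=> Ux; apply: filterS fh _; exact: open_nbhs_nbhs.
split=> [x Ux|v]; first by apply: near_eq_differentiable (fd x Ux); exact: fhn.
by apply: IH (fD v) => // x Ux; apply: near_eq_derive; exact: fhn.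
Unshelve. all: by end_near. Qed.

Lemma CkS (W : normedModType R) k (U U' : set V) (f : V -> W) :
  U' `<=` U -> Ck k U f -> Ck k U' f.
Proof.
elim: k => [|k IH] in f * => UU' /=; first by move=> fc x /UU'/fc.
by move=> [fd fD]; split=> [x /UU'/fd//|v]; exact: IH (fD v).
Qed.

Lemma Ck_pred (W : normedModType R) k (U : set V) (f : V -> W) :
  Ck k.+1 U f -> Ck k U f.
Proof.
elim: k => [|k IH] in f *.
  by move=> [fd _] x /fd/differentiable_continuous.
by move=> [fd fD]; split=> // v; exact: IH.
Qed.

Lemma Ck_cst (W : normedModType R) k (U : set V) (a : W) : Ck k U (cst a).
Proof.
elim: k a => [|k IH] a /=; first by move=> x _; exact: cvg_cst.
split=> // v; rewrite (_ : (fun _ => _) = cst 0)//.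
by apply/funext => x; rewrite derive_cst.
Qed.

Lemma Ck_add (W : normedModType R) k (U : set V) (f h : V -> W) : open U ->
  Ck k U f -> Ck k U h -> Ck k U (f + h).
Proof.
move=> oU; elim: k => [|k IH] in f h * => /=.
  by move=> fc hc x Ux; apply: continuousD; [exact: fc|exact: hc].
move=> [fd fD] [hd hD]; split=> [x Ux|v].
  by apply: differentiableD; [exact: fd|exact: hd].
apply: Ck_ext (IH _ _ (fD v) (hD v)) => // x Ux.
by rewrite deriveD//; apply: diff_derivable; [exact: fd|exact: hd].
Qed.

(** Induction by the Leibniz rule. The undifferentiated factors reappear there, and [Ck_pred] lowers
    their class by one for the induction hypothesis. *)
Lemma Ck_mul k (U : set V) (f h : V -> R) : open U ->
  Ck k U f -> Ck k U h -> Ck k U (f * h).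
Proof.
move=> oU; elim: k => [|k IH] in f h *.
  by move=> fc hc x Ux; apply: continuousM; [exact: fc|exact: hc].
move=> fk hk; have [[fd fD] [hd hD]] := (fk, hk); split=> [x Ux|v].
  by apply: differentiableM; [exact: fd|exact: hd].
apply: (@Ck_ext _ _ _ (f * (fun x => 'D_v h x) + h * (fun x => 'D_v f x))) => //.
  move=> x Ux; rewrite deriveM//; apply: diff_derivable; [exact: fd|exact: hd].
by apply: Ck_add => //; apply: IH => //; first [exact: Ck_pred | exact: fD | exact: hD].
Qed.

Lemma Ck_sum (W : normedModType R) k n (U : set V) (f : 'I_n -> V -> W) : open U ->
  (forall i, Ck k U (f i)) -> Ck k U (\sum_i f i).
Proof.
move=> oU fk; elim/big_ind: _ => //; first exact: Ck_cst.
by move=> a b; exact: Ck_add.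
Qed.

Lemma differentiable_rVP n (f : V -> 'rV[R]_n) x :
  differentiable f x <-> forall i, differentiable (fun y => f y 0 i) x.
Proof.
split=> [fd i|fd].
  exact: (differentiable_comp fd (differentiable_coord _ _ _)).
rewrite (_ : f = \sum_(i < n) (fun y => f y 0 i *: delta_mx 0 i)).
  by apply: differentiable_sum => i; exact: differentiableZl.
by apply/funext => y; rewrite fct_sumE {1}[f y]row_sum_delta.
Qed.

(** The coordinates of ['D_v f] are the derivatives of the coordinates wherever [f] is
    differentiable, that is on [U]; [Ck_ext] absorbs the restriction to [U]. *)
Lemma Ck_rVP n k (U : set V) (f : V -> 'rV[R]_n) : open U ->
  Ck k U f <-> forall i, Ck k U (fun y => f y 0 i).
Proof.
move=> oU; elim: k => [|k IH] in f *.
  split=> [fc i x Ux|fc x Ux].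
    exact: (continuous_comp (fc x Ux) (@coord_continuous _ _ _ 0 i (f x))).
  rewrite (_ : f = \sum_(i < n) (fun y => f y 0 i *: delta_mx 0 i)); last first.
    by apply/funext => y; rewrite fct_sumE {1}[f y]row_sum_delta.
  elim/big_ind: _ => [|a b|i _]; first exact: cvg_cst.
    exact: continuousD.
  exact: (continuousZr_tmp (fc i x Ux)).
have DE v x i : (differentiable f x) ->
    'D_v f x 0 i = 'D_v (fun y => f y 0 i) x.
  by move=> fd; rewrite derive_mx ?mxE//; exact: diff_derivable.
split=> [[fd fD] i|fk]; last split=> [x Ux|v].
- split=> [x Ux|v]; first exact: ((differentiable_rVP _ _).1 (fd x Ux)).
  apply: Ck_ext ((IH _).1 (fD v) i) => // x Ux.
  by rewrite DE//; exact: fd.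
- by apply/differentiable_rVP => i; have [+ _] := fk i; apply.
- apply/IH => i; have [fd fD] := fk i.
  apply: Ck_ext (fD v) => // x Ux; rewrite DE//.
  by apply/differentiable_rVP => j; have [+ _] := fk j; apply.
Qed.
End Calculus.

(** * The chain rule, and closure properties of the classes [of_class r] *)

Section ChainRule.
Local Open Scope ring_scope.
Import Order.TTheory GRing.Theory Num.Theory numFieldNormedType.Exports.
Context {R : realType}.

Lemma Ck_coord n k (U : set 'rV[R]_n) (i : 'I_n) :
  Ck k U (fun v : 'rV[R]_n => v 0 i : R).
Proof.
case: k => [|k]; first by move=> x _; exact: coord_continuous.
split=> [x _|w]; first exact: differentiable_coord.
rewrite (_ : (fun _ => _) = cst (w 0 i)); first exact: Ck_cst.
apply/funext => x; have dx : derivable (@id 'rV[R]_n) x w by exact: derivable_id.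
(* The derivative of a coordinate is read off as an entry of the derivative of the identity. *)
have := congr1 (fun M : 'rV_n => M 0 i) (derive_mx dx); by rewrite derive_id mxE.
Qed.

(** A scalar target makes the chain rule a sum of products covered by [Ck_mul]. The induction
    generalizes over [h] alone, since only partial derivatives of [h] get composed with the same
    [f]. *)
Lemma Ck_comp_scalar (V : normedModType R) m k (U : set V) (U' : set 'rV[R]_m)
    (f : V -> 'rV[R]_m) (h : 'rV[R]_m -> R) :
  open U -> open U' -> U `<=` f @^-1` U' ->
  Ck k U f -> Ck k U' h -> Ck k U (h \o f).
Proof.
move=> oU oU' UU'; elim: k => [|k IH] in h *.
  by move=> fc hc x Ux; apply: continuous_comp; [exact: fc | apply: hc; exact: UU'].
move=> fk hk; have [[fd fD] [hd hD]] := (fk, hk).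
split=> [x Ux|v].
  by apply: differentiable_comp; [exact: fd | apply: hd; exact: UU'].
apply: (@Ck_ext _ _ _ _ _ (\sum_i ((fun x => 'D_v f x 0 i) *
                       ((fun y => 'D_(delta_mx 0 i) h y) \o f)))) => //; last first.
  apply: Ck_sum => // i; apply: Ck_mul => //.
    exact: ((Ck_rVP _ _ oU).1 (fD v) i).
  by apply: IH; [exact: Ck_pred | exact: hD].
move=> x Ux; have hfx : differentiable h (f x) by apply: hd; exact: UU'.
rewrite [RHS]deriveE; last by apply: differentiable_comp => //; exact: fd.
rewrite diff_comp//=; last exact: fd.
rewrite -(deriveE v (fd x Ux)).
(* Expanding the vector ['D_v f x] in the standard basis turns the differential of [h] into a sum
   over its partial derivatives. *)
rewrite [X in _ = 'd h (f x) X]row_sum_delta linear_sum fct_sumE.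
by apply: eq_bigr => i _; rewrite linearZ -(deriveE _ hfx).
Qed.

Lemma Ck_comp (V : normedModType R) m n k (U : set V) (U' : set 'rV[R]_m)
    (f : V -> 'rV[R]_m) (h : 'rV[R]_m -> 'rV[R]_n) :
  open U -> open U' -> U `<=` f @^-1` U' ->
  Ck k U f -> Ck k U' h -> Ck k U (h \o f).
Proof.
move=> oU oU' UU' fk hk; apply/Ck_rVP => // i.
exact: (Ck_comp_scalar oU oU' UU' fk ((Ck_rVP _ _ oU').1 hk i)).
Qed.

Lemma of_class_ext (V W : normedModType R) r (U : set V) (f h : V -> W) : open U ->
  (forall x, U x -> f x = h x) -> of_class r U f -> of_class r U h.
Proof.
move=> oU fh; case: r => [fd x Ux|k|fk k]; [|exact: Ck_ext|exact: Ck_ext (fk k)].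
apply: near_eq_differentiable (fd x Ux); apply: filterS fh _.
exact: open_nbhs_nbhs.
Qed.

Lemma of_class_comp (V : normedModType R) m n r (U : set V) (U' : set 'rV[R]_m)
    (f : V -> 'rV[R]_m) (h : 'rV[R]_m -> 'rV[R]_n) :
  open U -> open U' -> U `<=` f @^-1` U' ->
  of_class r U f -> of_class r U' h -> of_class r U (h \o f).
Proof.
move=> oU oU' UU'; case: r => [fd hd x Ux|k|fk hk k]; last 2 first.
- exact: (Ck_comp oU oU' UU').
- exact: (Ck_comp oU oU' UU' (fk k) (hk k)).
by apply: differentiable_comp; [exact: fd | apply: hd; exact: UU'].
Qed.

Lemma of_class_rVP (V : normedModType R) n r (U : set V) (f : V -> 'rV[R]_n) :
  open U -> of_class r U f <-> forall i, of_class r U (fun y => f y 0 i : R).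
Proof.
move=> oU; case: r => [|k|] /=; [|exact: (Ck_rVP k.+1)|].
- split=> [fd i x Ux|fd x Ux]; first exact: ((differentiable_rVP _ _).1 (fd x Ux)).
  by apply/differentiable_rVP => i; exact: fd.
- split=> [fk i k|fk k]; first exact: ((Ck_rVP _ _ oU).1 (fk k)).
  by apply/Ck_rVP => // i; exact: fk.
Qed.

(** Every clause in the definition of a class is a condition at single points. This lets the
    intermediate chart of a composition vary with the point. *)
Lemma of_class_local (V W : normedModType R) r (U : set V) (f : V -> W) :
  (forall x, U x -> exists2 U', U' x & of_class r U' f) -> of_class r U f.
Proof.
have CkL k : (forall x, U x -> exists2 U', U' x & Ck k U' f) -> Ck k U f.
  elim: k => [|k IH] in f *.
    by move=> fk x /fk[U' U'x]; apply.
  move=> fk; split=> [x /fk[U' U'x [+ _]]|v]; first exact.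
  by apply: IH => x /fk[U' U'x [_ fD]]; exists U' => //; exact: fD.
case: r => [fd x /fd[U' U'x]|k|fk k]; [exact|exact: (CkL k.+1)|].
by apply: CkL => x /fk[U' U'x f']; exists U'.
Qed.

Lemma of_classS (V W : normedModType R) r (U U' : set V) (f : V -> W) :
  U' `<=` U -> of_class r U f -> of_class r U' f.
Proof.
move=> UU'; case: r => [fd x /UU'/fd//|k|fk k]; [exact: CkS|exact: CkS (fk k)].
Qed.

Lemma of_class_Cinf (V W : normedModType R) r (U : set V) (f : V -> W) :
  of_class Cinf U f -> of_class r U f.
Proof. by move=> fk; case: r => [|k|]//; [exact: (fk 1%N).1|exact: fk]. Qed.

Lemma of_class_row_mx (V : normedModType R) m n r (U : set V)
    (f : V -> 'rV[R]_m) (h : V -> 'rV[R]_n) : open U ->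
  of_class r U f -> of_class r U h -> of_class r U (fun x => row_mx (f x) (h x)).
Proof.
move=> oU /of_class_rVP fr /of_class_rVP hr; apply/of_class_rVP => // i.
rewrite -[i]splitK; case: (fintype.split i) => j /=.
  by under eq_fun do rewrite row_mxEl; exact: fr.
by under eq_fun do rewrite row_mxEr; exact: hr.
Qed.

Lemma of_class_lsubmx m n r (U : set 'rV[R]_(m + n)) : open U ->
  of_class r U (lsubmx : 'rV[R]_(m + n) -> 'rV[R]_m).
Proof.
move=> oU; apply: of_class_Cinf; apply/of_class_rVP => // i k.
by under eq_fun do rewrite mxE; exact: Ck_coord.
Qed.

Lemma of_class_rsubmx m n r (U : set 'rV[R]_(m + n)) : open U ->
  of_class r U (rsubmx : 'rV[R]_(m + n) -> 'rV[R]_n).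
Proof.
move=> oU; apply: of_class_Cinf; apply/of_class_rVP => // i k.
by under eq_fun do rewrite mxE; exact: Ck_coord.
Qed.
End ChainRule.
(** * Products and homeomorphic copies of topological spaces *)

Section Topology.

Lemma cluster_continuous (T U : topologicalType) (f : T -> U) (p q : T) :
  continuous f -> cluster (nbhs p) q -> cluster (nbhs (f p)) (f q).
Proof.
move=> fc pq A B fpA fqB; have [x [Ax Bx]] := pq _ _ (fc p _ fpA) (fc q _ fqB).
by exists (f x).
Qed.

Lemma hausdorff_inj (T U : topologicalType) (f : T -> U) :
  continuous f -> injective f -> hausdorff_space U -> hausdorff_space T.
Proof. by move=> fc fI hU p q /(cluster_continuous fc)/hU/fI. Qed.

(** A continuous map sends cluster points to cluster points, so both projections of [p] and [q]
    agree. *)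
Lemma hausdorff_prod (T U : topologicalType) :
  hausdorff_space T -> hausdorff_space U -> hausdorff_space (T * U)%type.
Proof.
move=> hT hU [p1 p2] [q1 q2] pq; congr (_, _).
  by apply: hT; apply: (@cluster_continuous (T * U)%type T fst _ _ _ pq) => x; exact: cvg_fst.
by apply: hU; apply: (@cluster_continuous (T * U)%type U snd _ _ _ pq) => x; exact: cvg_snd.
Qed.

Lemma continuous_for_pair (T U W : topologicalType) (f : T -> U) (h : T -> W) x :
  {for x, continuous f} -> {for x, continuous h} ->
  {for x, continuous (fun y => (f y, h y))}.
Proof. by move=> fc hc; apply: cvg_pair. Qed.

Lemma continuous_compT (T U W : topologicalType) (f : T -> U) (h : U -> W) :
  continuous f -> continuous h -> continuous (h \o f).
Proof. by move=> fc hc x; exact: (continuous_comp (fc x) (hc (f x))). Qed.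

Lemma fst_continuous (T U : topologicalType) : continuous (@fst T U).
Proof. by move=> x; exact: cvg_fst. Qed.

Lemma snd_continuous (T U : topologicalType) : continuous (@snd T U).
Proof. by move=> x; exact: cvg_snd. Qed.

Lemma open_setX (T U : topologicalType) (A : set T) (B : set U) :
  open A -> open B -> open (A `*` B).
Proof.
move=> oA oB; rewrite openE => -[x y] [/= Ax By].
by exists (A, B) => //; split; exact: open_nbhs_nbhs.
Qed.

Lemma second_countable_prod (T U : topologicalType) :
  @second_countable T -> @second_countable U -> @second_countable (T * U)%type.
Proof.
move=> [B cB [oB bB]] [C cC [oC bC]].
exists ((fun p => p.1 `*` p.2) @` (B `*` C)).
  by apply: sub_countable (countableX cB cC); exact: card_image_le.
split=> [_ [[b c] [/oB ob /oC oc] <-]|[x y] A [[V W] [xV yW] VWA]].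
  exact: open_setX.
have [[b [Bb bx] bV] [c [Cc cy] cW]] := (bB x V xV, bC y W yW).
exists (b `*` c); first by split => //; exists (b, c).
by move=> [u v] [/= bu cv]; apply: VWA; split; [exact: bV | exact: cW].
Qed.

Lemma second_countable_homeo (T U : topologicalType) (f : T -> U) (h : U -> T) :
  cancel h f -> continuous f -> continuous h -> @second_countable T -> @second_countable U.
Proof.
move=> hK fc hc [B cB [oB bB]]; exists (preimage h @` B).
  by apply: sub_countable cB; exact: card_image_le.
split=> [_ [b /oB ob <-]|x A xA]; first by apply: open_comp => // y _; exact: hc.
have [|b [Bb bx] bA] := bB (h x) (f @^-1` A).
  by apply: fc; rewrite hK.
exists (h @^-1` b); first by split => //; exists b.
by move=> u /= /bA /=; rewrite hK.
Qed.

(** The product is the union of crosses, each made of the fibre over some [x] and one fixed slice at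
    height [y]. All crosses share that slice. *)
Lemma connected_prod (T U : topologicalType) :
  connected [set: T] -> connected [set: U] -> connected [set: T * U].
Proof.
move=> cT cU.
(* The crosses need a base point in each factor; if a factor is empty, so is the product. *)
have [[y]|U0] := pselect ([set: U] !=set0); last first.
  suff -> : [set: T * U] = set0 by exact: connected0.
  by rewrite -subset0 => -[x y] _; apply: U0; exists y.
move=> _; rewrite (_ : setT = \bigcup_(x in [set: T])
   (((fun y' => (x, y')) @` [set: U]) `|` ((fun x' => (x', y)) @` [set: T]))); last first.
  by apply/seteqP; split => // -[a b] _; exists a => //; left; exists b.
have [[x]|T0] := pselect ([set: T] !=set0); last first.
  rewrite (_ : setT = set0) ?bigcup_set0; first exact: connected0.
  by rewrite -subset0 => x _; apply: T0; exists x.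
move=> _; apply: bigcup_connected => [|a _].
  by exists (x, y) => a _; right; exists x.
apply: connectedU; first by exists (a, y); split; [exists y | exists a].
- apply: connected_continuous_connected => //; apply: continuous_subspaceT => z.
  by apply: cvg_pair; [exact: cvg_cst | exact: cvg_id].
- apply: connected_continuous_connected => //; apply: continuous_subspaceT => z.
  by apply: cvg_pair; [exact: cvg_id | exact: cvg_cst].
Qed.

End Topology.
(** * Maps of a given class between manifolds *)

Section Charts.
Local Open Scope ring_scope.
Import Order.TTheory GRing.Theory Num.Theory numFieldNormedType.Exports.
Context {R : realType}.

(** Inside the open codomain of the chart, the image is the preimage of [V] under [cinv c], which is
    continuous there. *)
Lemma chart_image_open (T : topologicalType) n (c : chart R T n) (V : set T) :
  is_chart c -> open V -> open (cmap c @` (cdom c `&` V)).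
Proof.
move=> [_ oc cK _ ic] oV.
rewrite (_ : _ @` _ = ccod c `&` cinv c @^-1` V); last first.
  apply/seteqP; split => [_ [x [cx Vx] <-]|_ [[x cx <-]]].
    by split; [exists x | rewrite /= cK].
  by rewrite /= cK// => Vx; exists x.
rewrite openE => y [cy Vy]; apply: filterI; first exact: open_nbhs_nbhs.
by apply: (ic y cy); exact: open_nbhs_nbhs.
Qed.

Lemma preimage_open (T U : topologicalType) (f : T -> U) (V : set U) :
  continuous f -> open V -> open (f @^-1` V).
Proof. by move=> fc; apply: open_comp => x _; exact: fc. Qed.

Lemma continuous_row_mx (T : topologicalType) m n (f : T -> 'rV[R]_m)
    (h : T -> 'rV[R]_n) (x : T) :
  {for x, continuous f} -> {for x, continuous h} ->
  {for x, continuous (fun y => row_mx (f y) (h y))}.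
Proof.
move=> fc hc A /nbhs_ballP[e e0 eA].
have fe : nbhs x (f @^-1` ball (f x) e) := fc _ (nbhsx_ballx (f x) e e0).
have he : nbhs x (h @^-1` ball (h x) e) := hc _ (nbhsx_ballx (h x) e e0).
change (nbhs x [set y | A (row_mx (f y) (h y))]).
(* Balls of row vectors are tested entry by entry, so the same radius [e] works for both blocks. *)
apply: filterS2 fe he => y [_ fy] [_ hy]; apply: eA; split => // i j.
rewrite -[j]splitK; case: (fintype.split j) => k /=; first by rewrite !row_mxEl.
by rewrite !row_mxEr.
Qed.

Lemma is_chart_prod (T U : topologicalType) m n (c : chart R T m) (d : chart R U n) :
  is_chart c -> is_chart d -> is_chart (prod_chart c d).
Proof.
move=> [oc occ cK cc ic] [od odd dK dc id].
have ccodE : ccod (prod_chart c d) = lsubmx @^-1` ccod c `&` rsubmx @^-1` ccod d.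
  apply/seteqP; split => [_ [x [cx dx] <-]|v [[x cx xv] [y dy yv]]] /=.
    by rewrite row_mxKl row_mxKr; split; [exists x.1 | exists x.2].
  by exists (x, y) => //; rewrite /= xv yv hsubmxK.
split.
- exact: open_setX.
- rewrite ccodE; apply: openI; apply: preimage_open => //.
    exact: continuous_lsubmx.
  exact: continuous_rsubmx.
- by move=> [x y] [/= cx dy]; rewrite row_mxKl row_mxKr cK// dK.
- move=> [x y] [/= cx dy]; apply: continuous_row_mx.
    exact: (@continuous_comp (T * U)%type T _ fst (cmap c) (x, y) cvg_fst (cc x cx)).
  exact: (@continuous_comp (T * U)%type U _ snd (cmap d) (x, y) cvg_snd (dc y dy)).
- rewrite ccodE => v [/= cv dv].
  exact: (continuous_for_pair (continuous_comp (@continuous_lsubmx _ _ _ _ v) (ic _ cv))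
    (continuous_comp (@continuous_rsubmx _ _ _ _ v) (id _ dv))).
Qed.

(** The part of the manifold axioms that composing and pairing maps relies on. Isolating it lets
    these operations be used for a product or transported atlas before its transition maps are known
    to be smooth. *)
Definition chart_cover (T : topologicalType) n (A : set (chart R T n)) :=
  (forall c, A c -> is_chart c) /\ forall x, exists2 c, A c & cdom c x.

Lemma manifold_cover (T : topologicalType) n (A : set (chart R T n)) :
  differentiable_manifold A -> chart_cover A.
Proof. by case. Qed.

Lemma chart_cover_prod (T U : topologicalType) m n
    (A : set (chart R T m)) (B : set (chart R U n)) :
  chart_cover A -> chart_cover B -> chart_cover (prod_atlas A B).
Proof.
move=> [Ach Acov] [Bch Bcov]; split => [_ [c Ac [d Bd <-]]|[x y]].
  by apply: is_chart_prod; [exact: Ach | exact: Bch].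
have [[c Ac cx] [d Bd dy]] := (Acov x, Bcov y).
by exists (prod_chart c d) => //; exists c => //; exists d.
Qed.

(** Around a given point, a chart [b] at the image under [f] is inserted, and the local expression
    of [h \o f] becomes a composite of two local expressions. Locality of the class reduces the
    claim to this. *)
Lemma map_of_class_comp r (T U W : topologicalType) m n p
    (A : set (chart R T m)) (B : set (chart R U n)) (C : set (chart R W p))
    (f : T -> U) (h : U -> W) :
  chart_cover A -> chart_cover B -> chart_cover C ->
  map_of_class r A B f -> map_of_class r B C h -> map_of_class r A C (h \o f).
Proof.
move=> [Ach _] [Bch Bcov] [Cch _] [fc fr] [hc hr]; split.
  by move=> x; exact: (continuous_comp (fc x) (hc (f x))).
move=> c d Ac Cd; apply: of_class_local => _ [x [cx /= dx] <-].
have [b Bb bx] := Bcov (f x).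
have [oc od ob] : [/\ open (cdom c), open (cdom d) & open (cdom b)].
  by split; [have [] := Ach _ Ac | have [] := Cch _ Cd | have [] := Bch _ Bb].
have [_ _ cK _ _] := Ach _ Ac; have [_ _ bK _ _] := Bch _ Bb.
set V := cdom b `&` h @^-1` cdom d.
have oV : open (h @^-1` cdom d) by exact: preimage_open.
exists (cmap c @` (cdom c `&` f @^-1` V)); first by exists x.
have oW : open (cmap c @` (cdom c `&` f @^-1` V)).
  by apply: chart_image_open; [exact: Ach | apply: preimage_open => //; exact: openI].
apply: (@of_class_ext _ _ _ _ _ ((cmap d \o h \o cinv b) \o (cmap b \o f \o cinv c))) => //.
  by move=> _ [y [cy [/= by_ _]] <-]; rewrite /= cK// bK.
apply: (of_class_comp oW _ _ _ (hr _ _ Bb Cd)).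
- by apply: chart_image_open => //; exact: Bch.
- by move=> _ [y [cy [/= by_ dy]] <-]; rewrite /= cK//; exists (f y).
- apply: of_classS (fr _ _ Ac Bb) => _ [y [cy [/= by_ dy]] <-].
  by exists y.
Qed.

Lemma map_of_class_pair r (T U W : topologicalType) m n p
    (A : set (chart R T m)) (B : set (chart R U n)) (C : set (chart R W p))
    (f : T -> U) (h : T -> W) :
  chart_cover A -> chart_cover B -> chart_cover C ->
  map_of_class r A B f -> map_of_class r A C h ->
  map_of_class r A (prod_atlas B C) (fun x => (f x, h x)).
Proof.
move=> [Ach _] [Bch _] [Cch _] [fc fr] [hc hr]; split.
  by move=> x; apply: cvg_pair; [exact: fc | exact: hc].
move=> c _ Ac [b Bb [d Cd <-]].
have od : open (cdom d) by have [] := Cch _ Cd.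
have ob : open (cdom b) by have [] := Bch _ Bb.
apply: of_class_row_mx.
- apply: chart_image_open; first exact: Ach.
  apply: (@openI _ (f @^-1` cdom b) (h @^-1` cdom d)); exact: preimage_open.
- apply: of_classS (fr _ _ Ac Bb) => _ [y [cy [/= by_ dy]] <-].
  by exists y.
- apply: of_classS (hr _ _ Ac Cd) => _ [y [cy [/= by_ dy]] <-].
  by exists y.
Qed.

(** In charts the projection is [lsubmx] followed by a transition map of [A]. *)
Lemma map_of_class_fst r (T U : topologicalType) m n
    (A : set (chart R T m)) (B : set (chart R U n)) :
  differentiable_manifold A -> chart_cover B ->
  map_of_class r (prod_atlas A B) A fst.
Proof.
move=> Aman [Bch _]; have [Ach _] := manifold_cover Aman.
split=> [x|_ a' [a Aa [b Bb <-]] Aa']; first exact: cvg_fst.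
have oa' : open (cdom a') by have [] := Ach _ Aa'.
have oO : open (cmap (prod_chart a b) @` (cdom (prod_chart a b) `&` fst @^-1` cdom a')).
  apply: chart_image_open; first by apply: is_chart_prod; [exact: Ach | exact: Bch].
  by apply: preimage_open => // x; exact: cvg_fst.
have [_ _ _ _ trans] := Aman.
apply: (@of_class_comp _ _ _ _ _ _ (cmap a @` (cdom a `&` cdom a')) lsubmx
  (cmap a' \o cinv a) oO); last by apply: of_class_Cinf; exact: trans.
- by apply: chart_image_open => //; exact: Ach.
- by move=> _ [[x y] [[/= ax by_] /= a'x] <-]; rewrite /= row_mxKl; exists x.
- exact: of_class_lsubmx.
Qed.

Lemma map_of_class_snd r (T U : topologicalType) m n
    (A : set (chart R T m)) (B : set (chart R U n)) :
  chart_cover A -> differentiable_manifold B ->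
  map_of_class r (prod_atlas A B) B snd.
Proof.
move=> [Ach _] Bman; have [Bch _] := manifold_cover Bman.
split=> [x|_ b' [a Aa [b Bb <-]] Bb']; first exact: cvg_snd.
have ob' : open (cdom b') by have [] := Bch _ Bb'.
have oO : open (cmap (prod_chart a b) @` (cdom (prod_chart a b) `&` snd @^-1` cdom b')).
  apply: chart_image_open; first by apply: is_chart_prod; [exact: Ach | exact: Bch].
  by apply: preimage_open => // x; exact: cvg_snd.
have [_ _ _ _ trans] := Bman.
apply: (@of_class_comp _ _ _ _ _ _ (cmap b @` (cdom b `&` cdom b')) rsubmx
  (cmap b' \o cinv b) oO); last by apply: of_class_Cinf; exact: trans.
- by apply: chart_image_open => //; exact: Bch.
- by move=> _ [[x y] [[/= ax by_] /= b'y] <-]; rewrite /= row_mxKr; exists y.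
- exact: of_class_rsubmx.
Qed.

Lemma manifold_prod (T U : topologicalType) m n
    (A : set (chart R T m)) (B : set (chart R U n)) :
  differentiable_manifold A -> differentiable_manifold B ->
  differentiable_manifold (prod_atlas A B).
Proof.
move=> Aman Bman; have [hA scA _ _ _] := Aman; have [hB scB _ _ _] := Bman.
have [Acov Bcov] := (manifold_cover Aman, manifold_cover Bman).
have ABcov := chart_cover_prod Acov Bcov; have [ABch ABc] := ABcov.
split => //; [exact: hausdorff_prod | exact: second_countable_prod |].
(* The transition maps of the product atlas are the local expressions of the identity, seen as the
   pairing of the two projections. *)
have [_ +] := map_of_class_pair ABcov Acov Bcov
  (map_of_class_fst Cinf Aman Bcov) (map_of_class_snd Cinf Acov Bman).
move=> prodr c _ ABc' [a Aa [b Bb <-]].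
exact: (prodr c (prod_chart a b) ABc' (ex_intro2 _ _ a Aa (ex_intro2 _ _ b Bb erefl))).
Qed.

End Charts.

(** * Transport of a manifold structure along a homeomorphism *)

Section Transport.
Import numFieldNormedType.Exports.
Context {R : realType} (T U : topologicalType) (n : nat) (A : set (chart R T n)).
Context (phi : T -> U) (psi : U -> T).
Hypothesis phiK : cancel phi psi.
Hypothesis psiK : cancel psi phi.
Hypothesis phic : continuous phi.
Hypothesis psic : continuous psi.
Hypothesis Aman : differentiable_manifold A.
Let B := transport_atlas phi psi A.

Let image_phi (V : set T) : phi @` V = psi @^-1` V.
Proof.
by apply/seteqP; split => [_ [x Vx <-]|y Vy] /=; [rewrite phiK | exists (psi y)].
Qed.

Lemma is_chart_transport (c : chart R T n) : is_chart c ->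
  is_chart (Chart (phi @` cdom c) (cmap c \o psi) (phi \o cinv c)).
Proof.
move=> [oc occ cK cc ic].
have codE : ccod (Chart (phi @` cdom c) (cmap c \o psi) (phi \o cinv c)) = ccod c.
  apply/seteqP; split => [_ [_ [x cx <-] <-]|_ [x cx <-]] /=; rewrite ?phiK.
    by exists x.
  by exists (phi x); [exists x | rewrite /= phiK].
split=> [||_ /= [x cx <-]|_ /= [x cx <-]|].
- by rewrite /= image_phi; exact: preimage_open.
- by rewrite codE.
- by rewrite phiK cK.
- have ccx : {for psi (phi x), continuous (cmap c)} by rewrite phiK; exact: cc.
  exact: (@continuous_comp U T _ psi (cmap c) (phi x) (psic (x:=phi x)) ccx).
- rewrite codE => y cy.
  exact: (@continuous_comp _ T U (cinv c) phi y (ic y cy) (phic (x:=cinv c y))).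
Qed.

Let Bcov : chart_cover B.
Proof.
have [Ach Acov] := manifold_cover Aman.
split=> [_ [c Ac <-]|x]; first by apply: is_chart_transport; exact: Ach.
have [c Ac cx] := Acov (psi x); eexists; first by exists c.
by exists (psi x).
Qed.

(** Read in a chart and a transported chart, [phi] is a transition map of [A]. *)
Lemma map_of_class_transport r : map_of_class r A B phi.
Proof.
split=> // c _ Ac [d Ad <-] /=; have [_ _ Ach _ trans] := Aman.
have od : open (cdom d) by have [] := Ach _ Ad.
have := of_class_Cinf r (trans c d Ac Ad).
rewrite [phi @` _]image_phi.
have -> : phi @^-1` (psi @^-1` cdom d) = cdom d.
  by apply/funext => x; rewrite /preimage /= phiK.
apply: of_class_ext; first by apply: chart_image_open => //; exact: Ach.
by move=> x _ /=; rewrite phiK.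
Qed.

Lemma map_of_class_transportV r : map_of_class r B A psi.
Proof.
split=> // _ d [c Ac <-] Ad /=; have [_ _ Ach _ trans] := Aman.
have od : open (cdom d) by have [] := Ach _ Ad.
have := of_class_Cinf r (trans c d Ac Ad).
have -> : (cmap c \o psi) @` (phi @` cdom c `&` psi @^-1` cdom d)
    = cmap c @` (cdom c `&` cdom d).
  apply/seteqP; split => [_ [_ [[x cx <-]] /= + <-]|_ [x [cx dx] <-]] /=.
    by rewrite phiK => dx; exists x.
  by exists (phi x); rewrite /= phiK//; split => //; exists x.
apply: of_class_ext; first by apply: chart_image_open => //; exact: Ach.
by move=> x _ /=; rewrite phiK.
Qed.

Lemma manifold_transport : differentiable_manifold B.
Proof.
have [hT scT _ _ _] := Aman; have [Bch Bc] := Bcov.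
split => //.
- by apply: hausdorff_inj psic _ hT; exact: can_inj psiK.
- exact: second_countable_homeo psiK phic psic scT.
(* The transition maps of [B] are the local expressions of [phi \o psi], which is the identity. *)
- have [_ tr] := map_of_class_comp Bcov (manifold_cover Aman) Bcov
    (map_of_class_transportV Cinf) (map_of_class_transport Cinf).
  move=> c d Bc' Bd; have := tr c d Bc' Bd.
  by rewrite (_ : phi \o psi = id)//; apply/funext => x /=; rewrite psiK.
Qed.

End Transport.

(** * Local compactness of manifolds *)

Section LocallyCompact.
Local Open Scope ring_scope.
Import Order.TTheory GRing.Theory Num.Theory numFieldNormedType.Exports.
Context {R : realType}.

(** A small closed ball in the codomain of a chart is closed and bounded, hence compact. Its image
    under [cinv c] is a compact neighbourhood of [x], closed because the manifold is Hausdorff. *)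
Lemma manifold_locally_compact (T : topologicalType) n (A : set (chart R T n)) :
  differentiable_manifold A -> locally_compact [set: T].
Proof.
move=> [hT _ Ach Acov _] x _; rewrite withinET.
have [c Ac cx] := Acov x; have [oc occ cK cc ic] := Ach _ Ac.
have cody : ccod c (cmap c x) by exists x.
have /nbhs_closedballP[e eC] : nbhs (cmap c x) (ccod c) by exact: open_nbhs_nbhs.
set D := closed_ball (cmap c x) e%:num in eC.
have Dcpt : compact D.
  apply: bounded_closed_compact; last exact: closed_ball_closed.
  rewrite /D closed_ballE//; exists (`|cmap c x| + e%:num); split.
    by rewrite num_real.
  move=> M ltM v /= ve; apply: le_trans (ltW ltM).
  rewrite -[v](subrK (cmap c x)) addrC (le_trans (ler_normD _ _))//.
  by rewrite lerD2l distrC.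
have imcpt : compact (cinv c @` D).
  apply: continuous_compact => //; apply: continuous_in_subspaceT => v.
  by rewrite inE => /eC; exact: ic.
exists (cinv c @` D); last by split => //; exact: compact_closed.
have nD : nbhs x (cmap c @^-1` D).
  by apply: (cc x cx); apply/nbhs_closedballP; exists e.
have nc : nbhs x (cdom c) by exact: open_nbhs_nbhs.
by apply: filterS2 nc nD => y cy Dy; exists (cmap c y) => //; rewrite cK.
Qed.

End LocallyCompact.

(** * Pointwise group operations on maps into a Lie group *)

Section LieOperations.
Context {R : realType} {G : lieGroupType R} {T : topologicalType} {n : nat}.
Context (A : set (chart R T n)) (Acov : chart_cover A) (r : diff_class).
Implicit Types f h : T -> G.
Local Notation smooth := (map_of_class r A (@lie_atlas R G)).

Lemma map_of_class_Cinf (U W : topologicalType) m p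
    (B : set (chart R U m)) (C : set (chart R W p)) (f : U -> W) :
  map_of_class Cinf B C f -> map_of_class r B C f.
Proof.
by move=> [fc fr]; split=> // c d Bc Cd; apply: of_class_Cinf; exact: fr.
Qed.

Lemma lie_cover : chart_cover (@lie_atlas R G).
Proof. exact: manifold_cover lie_manifold. Qed.

(** Stated for maps from an arbitrary [T], so that a word in the group operations can be treated one
    operation at a time. *)
Lemma map_of_class_mulg f h : smooth f -> smooth h -> smooth (fun x => f x * h x).
Proof.
move=> fr hr; have GG := chart_cover_prod lie_cover lie_cover.
exact: (map_of_class_comp Acov GG lie_cover
  (map_of_class_pair Acov lie_cover lie_cover fr hr)
  (map_of_class_Cinf lie_mul_smooth)).
Qed.

Lemma map_of_class_invg f : smooth f -> smooth (fun x => (f x)^-1).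
Proof.
move=> fr; exact: (map_of_class_comp Acov lie_cover lie_cover fr
  (map_of_class_Cinf lie_inv_smooth)).
Qed.

End LieOperations.

Section LieContinuity.
Context {R : realType} {G : lieGroupType R} {T : topologicalType}.
Implicit Types f h : T -> G.

(** Continuity of the multiplication is the first half of its smoothness axiom. *)
Lemma continuous_mulg f h : continuous f -> continuous h ->
  continuous (fun x => f x * h x).
Proof.
move=> fc hc x; have [mc _] := @lie_mul_smooth R G.
exact: (continuous_comp (continuous_for_pair (fc x) (hc x)) (mc (f x, h x))).
Qed.

Lemma continuous_invg f : continuous f -> continuous (fun x => (f x)^-1).
Proof.
move=> fc x; have [ic _] := @lie_inv_smooth R G.
exact: (continuous_comp (fc x) (ic (f x))).
Qed.

End LieContinuity.
(** * The coset loop over Lie groups *)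

Section LieLoop.
Context {R : realType} {K P : lieGroupType R} {S : groupClosed P} (g : K -> subg S).
Hypothesis gdata : data_hyp g.
Let op := loop_op g.
Let e : GmodH K P S := std_coset (1, 1).
Local Notation L := (GmodH K P S).
(** The map [g] seen with values in [P], where its continuity and its class are measured. *)
Let G (k : K) : P := val (g k).

Lemma std_coset_continuous : continuous (@std_coset K P S : K * P -> L).
Proof. by apply/continuousP => A oA. Qed.

Lemma GmodH_coord_continuous : continuous (@Defs.coord K P S : L -> K * P).
Proof.
apply/continuousP => A oA.
(* Open sets of [L] are tested by pulling back along [std_coset], which undoes [coord]. *)
rewrite /open /= /GmodH_open /= (_ : _ @^-1` _ = A)//.
by apply/funext => p; rewrite /preimage /= std_cosetK.
Qed.

Lemma GmodH_connected : connected [set: K] -> connected [set: P] ->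
  connected [set: L].
Proof.
move=> cK cP; have -> : [set: L] = @std_coset K P S @` [set: K * P].
  by apply/seteqP; split => // A _; exists (Defs.coord A); rewrite ?coordK.
apply: connected_continuous_connected; first exact: connected_prod.
by apply: continuous_subspaceT; exact: std_coset_continuous.
Qed.

Lemma KP_manifold : differentiable_manifold (prod_atlas (@lie_atlas R K) (@lie_atlas R P)).
Proof. by apply: manifold_prod; exact: lie_manifold. Qed.

Lemma GmodH_manifold : differentiable_manifold (GmodH_atlas K S).
Proof.
exact: (manifold_transport (@std_cosetK K P S) (@coordK K P S)
  std_coset_continuous GmodH_coord_continuous KP_manifold).
Qed.

Let kc (A : L) : K := (Defs.coord A).1.
Let pc (A : L) : P := (Defs.coord A).2.

(** This and the next two identities remove the pattern matching on coordinates, leaving words in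
    [kc], [pc], [G] and the group operations to which closure lemmas apply. *)
Let opE (A B : L) : op A B = std_coset
  (kc A * kc B, pc A * G (kc A) * pc B * (G (kc A))^-1).
Proof.
by rewrite /op /loop_op /kc /pc; case: (Defs.coord A) (Defs.coord B) => a b [c d].
Qed.

Let ldivE (A B : L) : ldiv op e A B = std_coset
  ((kc A)^-1 * kc B, (G (kc A))^-1 * ((pc A)^-1 * pc B) * G (kc A)).
Proof.
rewrite ldiv_loop_op// /loop_ldiv /kc /pc.
by case: (Defs.coord A) (Defs.coord B) => a b [c d].
Qed.

Let rdivE (A B : L) : rdiv op e B A = std_coset
  (kc B * (kc A)^-1,
   pc B * (G (kc B * (kc A)^-1) * (pc A)^-1 * (G (kc B * (kc A)^-1))^-1)).
Proof.
rewrite rdiv_loop_op// /loop_rdiv /kc /pc.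
by case: (Defs.coord A) (Defs.coord B) => a b [c d].
Qed.

Section Continuity.
Hypothesis gc : continuous G.
Context {T : topologicalType}.
Implicit Types f h : T -> L.

Let kc_c f : continuous f -> continuous (fun x => kc (f x)).
Proof.
move=> fc.
exact: (continuous_compT (continuous_compT fc GmodH_coord_continuous)
  (@fst_continuous _ _)).
Qed.

Let pc_c f : continuous f -> continuous (fun x => pc (f x)).
Proof.
move=> fc.
exact: (continuous_compT (continuous_compT fc GmodH_coord_continuous)
  (@snd_continuous _ _)).
Qed.

Let G_c (k : T -> K) : continuous k -> continuous (fun x => G (k x)).
Proof. by move=> kcont; exact: (continuous_compT kcont gc). Qed.

Let std_c (k : T -> K) (p : T -> P) : continuous k -> continuous p ->
  continuous (fun x => std_coset (k x, p x) : L).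
Proof.
move=> kcont pcont; apply: (@continuous_compT _ _ _ (fun x => (k x, p x))).
  by move=> x; exact: (continuous_for_pair (kcont x) (pcont x)).
exact: std_coset_continuous.
Qed.

Lemma loop_op_continuous f h : continuous f -> continuous h ->
  continuous (fun x => op (f x) (h x)).
Proof.
move=> fc hc; under eq_fun do rewrite opE.
(* The loop descends through the word, one group operation or application of [G] at a time, down to
   the coordinate maps. *)
by apply: std_c; repeat first
  [exact: kc_c|exact: pc_c|apply: G_c|apply: continuous_mulg|apply: continuous_invg].
Qed.

Lemma loop_ldiv_continuous f h : continuous f -> continuous h ->
  continuous (fun x => ldiv op e (f x) (h x)).
Proof.
move=> fc hc; under eq_fun do rewrite ldivE.
by apply: std_c; repeat first
  [exact: kc_c|exact: pc_c|apply: G_c|apply: continuous_mulg|apply: continuous_invg].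
Qed.

Lemma loop_rdiv_continuous f h : continuous f -> continuous h ->
  continuous (fun x => rdiv op e (h x) (f x)).
Proof.
move=> fc hc; under eq_fun do rewrite rdivE.
by apply: std_c; repeat first
  [exact: kc_c|exact: pc_c|apply: G_c|apply: continuous_mulg|apply: continuous_invg].
Qed.

End Continuity.

Lemma loop_topological : continuous G -> topological_loop op e.
Proof.
move=> gc; split; first exact: loop_op_is_loop.
(* Joint continuity is the case where [f] and [h] are the two projections of [L * L]. *)
- exact: (loop_op_continuous gc (@fst_continuous L L) (@snd_continuous L L)).
- exact: (loop_ldiv_continuous gc (@fst_continuous L L) (@snd_continuous L L)).
- exact: (loop_rdiv_continuous gc (@fst_continuous L L) (@snd_continuous L L)).
Qed.

Section Smooth.
Context (r : diff_class).
Hypothesis gr : map_of_class r (@lie_atlas R K) (@lie_atlas R P) G.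
Context {T : topologicalType} {n : nat} (A : set (chart R T n)) (Acov : chart_cover A).
Implicit Types f h : T -> L.
Local Notation smoothL f := (map_of_class r A (GmodH_atlas K S) f).
Local Notation smoothK f := (map_of_class r A (@lie_atlas R K) f).
Local Notation smoothP f := (map_of_class r A (@lie_atlas R P) f).
Let Lcov := manifold_cover GmodH_manifold.
Let KPcov := manifold_cover KP_manifold.

Let coord_r f : smoothL f ->
  map_of_class r A (prod_atlas (@lie_atlas R K) (@lie_atlas R P)) (fun x => Defs.coord (f x)).
Proof.
move=> fr; apply: (map_of_class_comp Acov Lcov KPcov fr).
exact: (map_of_class_transportV (@std_cosetK K P S) GmodH_coord_continuous KP_manifold).
Qed.

Let kc_r f : smoothL f -> smoothK (fun x => kc (f x)).
Proof.
move=> /coord_r fr; apply: (map_of_class_comp Acov KPcov lie_cover fr).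
by apply: map_of_class_fst; [exact: lie_manifold|exact: lie_cover].
Qed.

Let pc_r f : smoothL f -> smoothP (fun x => pc (f x)).
Proof.
move=> /coord_r fr; apply: (map_of_class_comp Acov KPcov lie_cover fr).
by apply: map_of_class_snd; [exact: lie_cover|exact: lie_manifold].
Qed.

Let G_r (k : T -> K) : smoothK k -> smoothP (fun x => G (k x)).
Proof. by move=> kr; exact: (map_of_class_comp Acov lie_cover lie_cover kr gr). Qed.

Let std_r (k : T -> K) (p : T -> P) : smoothK k -> smoothP p ->
  smoothL (fun x => std_coset (k x, p x) : L).
Proof.
move=> kr pr; apply: (map_of_class_comp Acov KPcov Lcov
  (map_of_class_pair Acov lie_cover lie_cover kr pr)).
exact: (map_of_class_transport (@std_cosetK K P S) (@coordK K P S)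
  std_coset_continuous KP_manifold).
Qed.

Lemma loop_op_of_class f h : smoothL f -> smoothL h ->
  smoothL (fun x => op (f x) (h x)).
Proof.
move=> fr hr; under eq_fun do rewrite opE.
by apply: std_r; repeat first
  [exact: kc_r|exact: pc_r|apply: G_r|apply: map_of_class_mulg|apply: map_of_class_invg].
Qed.

Lemma loop_ldiv_of_class f h : smoothL f -> smoothL h ->
  smoothL (fun x => ldiv op e (f x) (h x)).
Proof.
move=> fr hr; under eq_fun do rewrite ldivE.
by apply: std_r; repeat first
  [exact: kc_r|exact: pc_r|apply: G_r|apply: map_of_class_mulg|apply: map_of_class_invg].
Qed.

End Smooth.

Lemma loop_almost_differentiable r :
  map_of_class r (@lie_atlas R K) (@lie_atlas R P) G ->
  almost_differentiable_loop r (GmodH_atlas K S) op e.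
Proof.
move=> gr; have Lman := GmodH_manifold; have Lcov := manifold_cover Lman.
have LLcov := chart_cover_prod Lcov Lcov.
split=> //; first exact: loop_op_is_loop.
- exact: (loop_op_of_class gr LLcov (map_of_class_fst r Lman Lcov)
    (map_of_class_snd r Lcov Lman)).
- exact: (loop_ldiv_of_class gr LLcov (map_of_class_fst r Lman Lcov)
    (map_of_class_snd r Lcov Lman)).
Qed.

End LieLoop.

Theorem mainTheorem3 :
  (forall (K P : groupType) (S : groupClosed P) (g : K -> subg S),
    data_hyp g ->
    (* (1) *)
    [/\ forall A : GmodH K P S, exists! p : K * P, A = std_coset p,
        exists sigma : GmodH K P S -> Ggrp K S,
          [/\ forall A, cosetH (sigma A) = A,
              forall (x : K) (y : P),
                sigma (std_coset (x, y)) = (x, y * val (g x), g x)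
            & range sigma = Mset g]
      & forall A B : GmodH K P S, exists! z, Mset g z /\ actG z A = B]
    /\
    let op := loop_op g in
    let e : GmodH K P S := std_coset (1, 1) in
    (* (2) *)
    [/\ forall (a1 a2 : K) (b1 b2 : P),
          op (std_coset (a1, b1)) (std_coset (a2, b2)) =
          std_coset (a1 * a2, b1 * val (g a1) * b2 * (val (g a1))^-1),
        proper_loop op e,
        injective (@actG K P S) /\
          perm_generated (range op) = range (@actG K P S),
        @Hsub K P S = [set z | actG z e = e]
      & range op = [set actG z | z in Mset g]]
    /\
    (* (3) *)
    let N : set (GmodH K P S) := [set std_coset (1, l) | l in [set: P]] in
    let Q : set (GmodH K P S) := [set std_coset (k, 1) | k in [set: K]] in
    [/\ normal_subloop op e N /\ isomorphic_to_group op N P,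
        loop_subgroup op e Q /\ isomorphic_to_group op Q K
      & semidirect_product op e N Q])
  /\
  (* (4) *)
  (forall (R : realType) (K P : lieGroupType R) (S : groupClosed P)
      (g : K -> subg S),
    data_hyp g ->
    connected [set: K] -> connected [set: P] ->
    continuous (fun k => val (g k)) ->
    let op := loop_op g in
    let e : GmodH K P S := std_coset (1, 1) in
    [/\ connected [set: GmodH K P S], locally_compact [set: GmodH K P S],
        topological_loop op e & proper_loop op e]
    /\
    forall r : diff_class,
      map_of_class r (@lie_atlas R K) (@lie_atlas R P) (fun k => val (g k)) ->
      [/\ connected [set: GmodH K P S],
          almost_differentiable_loop r (GmodH_atlas K S) op e
        & proper_loop op e]).
Proof.
split=> [K P S g gdata|R K P S g gdata cK cP gc].
- split.
    split; [exact: std_coset_exists_unique|exact: Mset_section|].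
    exact: Mset_sharply_transitive.
  split.
    split; [exact: loop_opE|exact: loop_op_proper| | |exact: range_loop_op].
      by split; [exact: actG_inj gdata|exact: perm_generated_loop_op].
    exact: Hsub_stabilizer.
  split; last exact: semidirect_N_Q.
    by split; [exact: N_normal|exact: N_isomorphic].
  by split; [exact: Q_subgroup|exact: Q_isomorphic].
- have cL : connected [set: GmodH K P S] by exact: GmodH_connected.
  have proper := loop_op_proper gdata.
  split=> [|r gr]; split => //.
  + exact: manifold_locally_compact GmodH_manifold.
  + exact: loop_topological.
  + exact: loop_almost_differentiable.
Qed.
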